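(* Let $\Lambda$ be a totally ordered nontrivial abelian group and let $\alpha,\beta,\gamma,\delta\in\Lambda$ be such that (1) $\gamma-\alpha-\beta\in 2\Lambda$ and $\delta-\alpha-\beta\in 2\Lambda$; (2) either $\gamma=\delta>\alpha+\beta$ or $\max\{\gamma,\delta\}=\alpha+\beta$; (3) $\alpha>0$, $\beta>0$, and $|\alpha-\beta|<\min\{\gamma,\delta\}$. Define $f\colon\Sigma\times\Sigma\to\Lambda$ as follows: $$f(a,a)=2\alpha,\quad f(b,b)=2\beta,\quad f(a,b)=\gamma,\quad f(a,b^{-1})=\delta,$$ $$f(x,y)=f(y,x)=f(y^{-1},x^{-1}),\quad f(x,x^{-1})=0\quad\text{for all }x,y\in\Sigma.$$ Let $\lVert\cdot\rVert\colon F(a,b)\to\Lambda_{+}$ be defined by $\lVert 1\rVert:=0$ and, for $g\ne1$, $$\lVert g\rVert:=\frac12\left(\sum_{i=1}^{n-1}f(x_i,x_{i+1})+f(x_n,x_1)\right),$$ where $x_1\dots x_n$, with $x_i\in\Sigma$ $(1\le i\le n)$, is any cyclically reduced word representing an element of $F(a,b)$ conjugated to $g$. Then $\lVert\cdot\rVert$ is a (well-defined) pseudo-length on $F(a,b)$.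
   Context: $\Lambda$ is written additively; $\Lambda_{+}:=\{\lambda\in\Lambda:\lambda\ge 0\}$, $|\lambda|:=\max\{\lambda,-\lambda\}$, $2\Lambda:=\{2\lambda:\lambda\in\Lambda\}$. For $\lambda\in 2\Lambda$, $\frac12\lambda$ denotes the unique $\lambda'\in\Lambda$ with $2\lambda'=\lambda$. $\Sigma:=\{a,b,a^{-1},b^{-1}\}$ is an alphabet of four distinct symbols with the involution $x\mapsto x^{-1}$ exchanging $a\leftrightarrow a^{-1}$, $b\leftrightarrow b^{-1}$. $F(a,b)$ is the free group over $\{a,b\}$. A nonempty word $x_1\dots x_n$ over $\Sigma$ is cyclically reduced if $x_i\ne x_{i+1}^{-1}$ for $1\le i<n$ and $x_n\ne x_1^{-1}$. Every $g\in F(a,b)$ is conjugated to an element represented by a cyclically reduced word, unique up to cyclic shift. A function $\lVert\cdot\rVert\colon G\to\Lambda_{+}$ on a group $G$ is a pseudo-length if: (A0) $\max\{0,\lVert gh\rVert-\lVert g\rVert-\lVert h\rVert\}\in 2\Lambda$ for any $g,h\in G$ with $\lVert g\rVert>0$, $\lVert h\rVert>0$; (A1) $\lVert ghg^{-1}\rVert=\lVert h\rVert$ for any $g,h\in G$; (A2) $\lVert gh\rVert=\lVert gh^{-1}\rVert$ or $\max\{\lVert gh\rVert,\lVert gh^{-1}\rVert\}\le\lVert g\rVert+\lVert h\rVert$, for any $g,h\in G$; (A3) $\lVert gh\rVert=\lVert gh^{-1}\rVert>\lVert g\rVert+\lVert h\rVert$ or $\max\{\lVert gh\rVert,\lVert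 gh^{-1}\rVert\}=\lVert g\rVert+\lVert h\rVert$, for any $g,h\in G$ with $\lVert g\rVert>0$, $\lVert h\rVert>0$. *)

(* Defs.v *)
From HB Require Import structures.
From mathcomp Require Import all_boot all_order ssralg orderedzmod.

Set Implicit Arguments.
Unset Strict Implicit.
Unset Printing Implicit Defensive.

Import Order.TTheory GRing.Theory.

Local Open Scope ring_scope.

(* MathComp's porderZmodType has no axiom relating the order to the addition. *)
HB.mixin Record Zmodule_isOrdered L of Order.Total ring_display L
    & GRing.Zmodule L := {
  omod_lerD2l : forall z x y : L, x <= y -> z + x <= z + y
}.

#[short(type="orderedZmodType")]
HB.structure Definition OrderedZmodule :=
  { L of Order.Total ring_display L & GRing.Zmodule L & Zmodule_isOrdered L }.

Section OrderedZmodule.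
Variable L : orderedZmodType.

Definition omod_abs (x : L) : L := Num.max x (- x).

(* Membership in 2L. *)
Definition in_double (x : L) : Prop := exists y : L, x = y *+ 2.

End OrderedZmodule.

Record pseudo_length (G : groupType) (L : orderedZmodType) (l : G -> L) :
    Prop := PseudoLength {
  plen_ge0 : forall g, 0 <= l g;
  plen_A0 : forall g h, 0 < l g -> 0 < l h ->
    in_double (Num.max 0 (l (g * h)%g - l g - l h));
  plen_A1 : forall g h, l (g * h * g^-1)%g = l h;
  plen_A2 : forall g h,
    l (g * h)%g = l (g * h^-1)%g \/
    Num.max (l (g * h)%g) (l (g * h^-1)%g) <= l g + l h;
  plen_A3 : forall g h, 0 < l g -> 0 < l h ->
    (l (g * h)%g = l (g * h^-1)%g /\ l g + l h < l (g * h^-1)%g) \/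
    Num.max (l (g * h)%g) (l (g * h^-1)%g) = l g + l h
}.

(* The free group on T, as reduced words over T and its formal inverses: the  *)
(* letter (t, false) is t and (t, true) is t^-1.                              *)
Section FreeGroup.
Variable T : choiceType.

Definition letter := (T * bool)%type.

Implicit Types (x y : letter) (u v w : seq letter).

Definition letter_inv x : letter := (x.1, ~~ x.2).

Definition noncancel : rel letter := fun x y => x != letter_inv y.

Definition reduced w := sorted noncancel w.

Definition cyclically_reduced w := (w != [::]) && cycle noncancel w.

Definition push x w :=
  if w is y :: w' then if x == letter_inv y then w' else x :: w else [:: x].

Definition reduce w := foldr push [::] w.

Definition word_inv w := rev (map letter_inv w).

Lemma letter_invK : involutive letter_inv.
Proof. by case=> t e; rewrite /letter_inv /= negbK. Qed.

Lemma push_reduced x w : reduced w -> reduced (push x w).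
Proof.
case: w => [|y w] //= yw; case: ifP => [_|/negbT xy]; first exact: path_sorted yw.
by rewrite /= yw andbT.
Qed.

Lemma foldr_push_reduced u v : reduced v -> reduced (foldr push v u).
Proof. by elim: u => //= x u IHu /IHu; apply: push_reduced. Qed.

Lemma reduce_reduced w : reduced (reduce w).
Proof. exact: foldr_push_reduced. Qed.

Lemma reduce_id w : reduced w -> reduce w = w.
Proof.
elim: w => //= x w IHw xw; rewrite (IHw (path_sorted xw)).
by case: w xw {IHw} => //= y w /andP[/negbTE xy _]; rewrite xy.
Qed.

Lemma pushK x w : reduced w -> push (letter_inv x) (push x w) = w.
Proof.
case: w => [|y w] /=; first by rewrite eqxx.
have [->|nxy] := eqVneq x (letter_inv y); last by rewrite /= eqxx.
rewrite letter_invK; case: w => //= z w /andP[nyz _].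
by rewrite (negbTE nyz).
Qed.

Lemma foldr_push_push x u v :
  reduced v -> foldr push v (push x u) = push x (foldr push v u).
Proof.
case: u => //= y u rv; case: eqP => // ->.
by rewrite pushK ?foldr_push_reduced.
Qed.

Lemma foldr_push_reduce u v :
  reduced v -> foldr push v (reduce u) = foldr push v u.
Proof. by move=> rv; elim: u => //= x u IHu; rewrite foldr_push_push ?IHu. Qed.

Lemma reduce_catr u v : reduce (u ++ reduce v) = reduce (u ++ v).
Proof. by rewrite /reduce !foldr_cat -!/(reduce _) reduce_id ?reduce_reduced. Qed.

Lemma reduce_catl u v : reduce (reduce u ++ v) = reduce (u ++ v).
Proof.
by rewrite {1 3}/reduce !foldr_cat -/(reduce _) foldr_push_reduce ?reduce_reduced.
Qed.

Lemma word_invK : involutive word_inv.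
Proof. by move=> w; rewrite /word_inv map_rev revK (mapK letter_invK). Qed.

Lemma word_inv_reduced w : reduced w -> reduced (word_inv w).
Proof.
rewrite /reduced /word_inv rev_sorted sorted_map; apply: sub_sorted => x y.
by rewrite /= /noncancel letter_invK eq_sym.
Qed.

Lemma reduce_mulVw w : reduce (word_inv w ++ w) = [::].
Proof.
elim: w => //= x w IHw; rewrite /word_inv /= rev_cons cat_rcons -/(word_inv w).
rewrite -reduce_catr /= pushK ?reduce_reduced // reduce_catr.
exact: IHw.
Qed.

Record freegroup := FreeGroup { fg_word : seq letter; _ : reduced fg_word }.

HB.instance Definition _ := [isSub for fg_word].
HB.instance Definition _ := [Choice of freegroup by <:].

(* The element represented by an arbitrary word. *)
Definition word_elt w : freegroup := FreeGroup (reduce_reduced w).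

Definition fg_one : freegroup := word_elt [::].
Definition fg_mul (g h : freegroup) := word_elt (fg_word g ++ fg_word h).
Definition fg_inv (g : freegroup) := word_elt (word_inv (fg_word g)).

Fact fg_mulA : associative fg_mul.
Proof.
by move=> f g h; apply: val_inj; rewrite /= reduce_catr reduce_catl catA.
Qed.

Fact fg_mul1g : left_id fg_one fg_mul.
Proof. by case=> w rw; apply: val_inj; rewrite /= reduce_id. Qed.

Fact fg_mulg1 : right_id fg_one fg_mul.
Proof. by case=> w rw; apply: val_inj; rewrite /= cats0 reduce_id. Qed.

Fact fg_mulVg : left_inverse fg_one fg_inv fg_mul.
Proof.
by case=> w rw; apply: val_inj; rewrite /= reduce_catl reduce_mulVw.
Qed.

Fact fg_mulgV : right_inverse fg_one fg_inv fg_mul.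
Proof.
case=> w rw; apply: val_inj; rewrite /= reduce_catr -{1}(word_invK w).
by rewrite reduce_mulVw.
Qed.

HB.instance Definition _ :=
  isGroup.Build freegroup fg_mulA fg_mul1g fg_mulg1 fg_mulVg fg_mulgV.

Lemma word_elt_cat u v : word_elt (u ++ v) = (word_elt u * word_elt v)%g.
Proof. by apply: val_inj; rewrite /= reduce_catl reduce_catr. Qed.

Definition fg_gen (t : T) : freegroup := word_elt [:: (t, false)].

Lemma word_elt_letter_inv x :
  word_elt [:: letter_inv x] = (word_elt [:: x])^-1%g.
Proof. by apply: val_inj. Qed.

Lemma freegroup_universal (G : groupType) (phi : T -> G) :
  exists m : freegroup -> G,
    [/\ {morph m : g h / (g * h)%g}, (forall t, m (fg_gen t) = phi t) &
        forall m' : freegroup -> G, {morph m' : g h / (g * h)%g} ->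
          (forall t, m' (fg_gen t) = phi t) -> m' =1 m].
Proof.
pose ph x : G := if x.2 then (phi x.1)^-1%g else phi x.1.
pose ev w : G := foldr (fun x r => (ph x * r)%g) 1%g w.
have phV x : ph (letter_inv x) = (ph x)^-1%g.
  by case: x => t [] /=; rewrite /ph /= ?invgK.
have ev_cat u v : ev (u ++ v) = (ev u * ev v)%g.
  by elim: u => [|x u IHu] /=; rewrite ?mul1g // IHu mulgA.
have ev_push x w : ev (push x w) = (ph x * ev w)%g.
  case: w => //= y w; case: eqP => //= ->.
  by rewrite phV mulgA mulVg mul1g.
have ev_red w : ev (reduce w) = ev w.
  by elim: w => //= x w IHw; rewrite ev_push IHw.
exists (fun g => ev (fg_word g)); split=> [g h|t|m' m'M m'g g].
- by rewrite /= ev_red ev_cat.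
- by rewrite /= mulg1.
have m'1 : m' 1%g = 1%g.
  by apply: (mulgI (m' 1%g)); rewrite -m'M !mulg1.
have m'V h : m' h^-1%g = (m' h)^-1%g.
  by apply: (mulgI (m' h)); rewrite -m'M !mulgV.
have m'x x : m' (word_elt [:: x]) = ph x.
  by case: x => t []; rewrite ?m'g // (word_elt_letter_inv (t, false)) m'V m'g.
case: g => w rw; have -> : FreeGroup rw = word_elt w.
  by apply: val_inj; rewrite /= reduce_id.
rewrite /= ev_red; elim: w {rw} => //= x w IHw.
by rewrite (word_elt_cat [:: x]) m'M m'x IHw.
Qed.

End FreeGroup.

(* F(a, b) is freegroup bool, with a and b the generators false and true. *)
Notation Sigma := (letter bool).
Definition la : Sigma := (false, false).
Definition lb : Sigma := (true, false).

Section Weight.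
Variable L : orderedZmodType.
Implicit Types (f : Sigma -> Sigma -> L).

Record is_weight (alpha beta gamma delta : L) f : Prop := IsWeight {
  weight_aa : f la la = alpha *+ 2;
  weight_bb : f lb lb = beta *+ 2;
  weight_ab : f la lb = gamma;
  weight_abV : f la (letter_inv lb) = delta;
  weight_sym : forall x y, f x y = f y x;
  weight_inv : forall x y, f x y = f (letter_inv y) (letter_inv x);
  weight_V : forall x, f x (letter_inv x) = 0
}.

(* These equations determine a unique function. *)
Lemma is_weightP alpha beta gamma delta f :
  is_weight alpha beta gamma delta f <->
  forall x y, f x y =
    if x.1 == y.1 then
      if x.2 == y.2 then (if x.1 then beta else alpha) *+ 2 else 0
    else if x.2 == y.2 then gamma else delta.
Proof.
split=> [[aa bb ab aB fC fV f0] x y|fE]; last first.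
  split=> [||||x y|x y|x]; rewrite !fE //.
  - by case: x y => [[] []] [[] []].
  - by case: x y => [[] []] [[] []].
  - by case: x => [[] []].
have AA : f (letter_inv la) (letter_inv la) = alpha *+ 2 by rewrite -fV.
have BB : f (letter_inv lb) (letter_inv lb) = beta *+ 2 by rewrite -fV.
have BA : f (letter_inv lb) (letter_inv la) = gamma by rewrite -fV.
have Ab : f lb (letter_inv la) = delta by rewrite -aB [RHS]fV.
rewrite /la /lb /letter_inv /= in aa bb ab aB AA BB BA Ab.
case: x y => [[] []] [[] []] /=;
  first [ exact: aa | exact: bb | exact: ab | exact: aB | exact: AA | exact: BB
        | exact: BA | exact: Ab | exact: f0 (_, true) | exact: f0 (_, false)
        | rewrite fC; first [ exact: ab | exact: aB | exact: BA | exact: Ab ] ].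
Qed.

(* For w = x_1 ... x_n, the sum of the f x_i x_{i+1}, plus f x_n x_1. *)
Definition cyclic_weight f (w : seq Sigma) : L :=
  \sum_(i < (size w).-1) f (nth la w i) (nth la w i.+1)
    + f (last la w) (head la w).

(* The halving of the sum is stated as l g *+ 2 = sum, for every choice of    *)
(* the word w.                                                                *)
Definition is_length f (l : freegroup bool -> L) : Prop :=
  l 1%g = 0 /\
  forall g w, g != 1%g -> cyclically_reduced w ->
    (exists h, word_elt w = (h * g * h^-1)%g) ->
    l g *+ 2 = cyclic_weight f w.

End Weight.

(* Main.v *)
Require Import Defs.
From HB Require Import structures.
From mathcomp Require Import all_boot all_order ssralg orderedzmod.

Set Implicit Arguments.
Unset Strict Implicit.
Unset Printing Implicit Defensive.

Import Order.TTheory GRing.Theory.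

Local Open Scope ring_scope.

(* Put d (x, y) = f (x^-1, y) on the four directions at a vertex of the       *)
(* Cayley tree of F(a, b). Hypotheses (2) and (3) make d a metric             *)
(* satisfying the four-point condition, hence twice the metric of a tree with *)
(* four ends; blowing up every vertex to this tree gives an action for which  *)
(* the sum over a cyclically reduced word is twice the translation length.    *)
(* Two facts carry the argument. First, the triangle inequality for d shows   *)
(* that cancellation, linear or cyclic, does not increase the cyclic sum, so  *)
(* every word w, reduced or not, satisfies 2 ||w|| <= sum w. Second, after a  *)
(* simultaneous conjugation two nontrivial elements are u and s v s^-1 with u *)
(* and v cyclically reduced, in one of three positions:                       *)
(* - the axes share an edge: then ||gh|| = ||g|| + ||h|| up to orientation,   *)
(*   and ||gh^-1|| is bounded by the first fact;                              *)
(* - the axes share one vertex: the four-point condition at that vertex is    *)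
(*   exactly the alternative of (A3);                                         *)
(* - the axes are disjoint: ||gh|| = ||gh^-1|| exceeds ||g|| + ||h|| by twice *)
(*   the length of the bridge between them.                                   *)

(** Well-definedness: with [gamma = alpha + beta + 2p] and [delta = alpha + beta + 2q], each weight
    [f x y] is [arm x + arm y] plus a double. Around a cycle every arm is counted twice, so the
    cyclic sum has an explicit half ([cyclic_weight_half]). The choice of word does not matter,
    because conjugate cyclically reduced words are rotations of each other
    ([cyclically_reduced_conj]).

    Axioms: hypothesis (2) becomes [isosceles 0 p q], and (3) says that [alpha] and [beta] stay
    positive after adding [p] or [q]. From these follow the local facts [weight_triangle],
    [weight_triple] and [weight_four_ends]. The predicate [compatible] packages what (A0), (A2) and
    (A3) require of a nontrivial pair. It is stable under inversion of either element and under
    simultaneous conjugation. Hence [compatible_words] can absorb letters of the conjugator [s]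
    until one of [compatible_eq_heads], [compatible_four_heads] and [compatible_bridge] applies, one
    for each relative position of the axes. *)

Section OrderedZmoduleTheory.
Variable L : orderedZmodType.
Implicit Types x y z t : L.

Lemma omod_leD2l z : {mono +%R z : x y / x <= y}.
Proof.
move=> x y; apply/idP/idP; last exact: omod_lerD2l.
by move/(omod_lerD2l (- z)); rewrite !addKr.
Qed.

Lemma omod_ltD2l z : {mono +%R z : x y / x < y}.
Proof. exact/leW_mono/omod_leD2l. Qed.

Lemma omod_leD x y z t : x <= y -> z <= t -> x + z <= y + t.
Proof.
move=> xy zt; apply: (@le_trans _ _ (x + t)); first by rewrite omod_leD2l.
by rewrite ![_ + t]addrC omod_leD2l.
Qed.

Lemma omod_ltD x y z t : x < y -> z <= t -> x + z < y + t.
Proof.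
move=> xy zt; apply: (@le_lt_trans _ _ (x + t)); first by rewrite omod_leD2l.
by rewrite ![_ + t]addrC omod_ltD2l.
Qed.

Lemma omod_addr_gt0 x y : 0 < x -> 0 <= y -> 0 < x + y.
Proof. by move=> x0 y0; rewrite -(addr0 0) omod_ltD. Qed.

Lemma omod_addr_ge0 x y : 0 <= x -> 0 <= y -> 0 <= x + y.
Proof. by move=> x0 y0; rewrite -(addr0 0) omod_leD. Qed.

Lemma omod_sub_gt0 x y : (0 < y - x) = (x < y).
Proof. by rewrite -(omod_ltD2l x) addr0 addrC subrK. Qed.

Lemma omod_lt_double : {mono (fun x => x *+ 2) : x y / x < y}.
Proof.
apply: leW_mono; apply: le_mono => x y xy.
by rewrite !mulr2n omod_ltD // ltW.
Qed.

Lemma omod_le_double : {mono (fun x => x *+ 2) : x y / x <= y}.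
Proof. by move=> x y; rewrite !leNgt omod_lt_double. Qed.

Lemma omod_double_inj : injective (fun x => x *+ 2).
Proof. exact: (inc_inj omod_le_double). Qed.

Lemma omod_double_gt0 x : (0 < x *+ 2) = (0 < x).
Proof. by rewrite -{1}(mul0rn _ 2) omod_lt_double. Qed.

(* Equivalently, the two largest of r, s and t are equal. *)
Definition isosceles r s t := s = t /\ r < t \/ Num.max s t = r.

Lemma isosceles_mono (F : L -> L) r s t : {mono F : x y / x <= y} ->
  isosceles r s t -> isosceles (F r) (F s) (F t).
Proof.
move=> Fm [[-> rt]|<-]; [left; split=> //; by rewrite (leW_mono Fm)|right].
by case: (leP s t) => [st|/ltW ts]; [apply/max_idPr|apply/max_idPl]; rewrite Fm.
Qed.

(** Applied to doubling, this transfers the condition from cyclic sums to lengths without dividing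
    in [L]. *)
Lemma isosceles_inv_mono (F : L -> L) r s t : {mono F : x y / x <= y} ->
  isosceles (F r) (F s) (F t) -> isosceles r s t.
Proof.
move=> Fm [[/(inc_inj Fm)-> rt]|]; first by left; rewrite -(leW_mono Fm).
move=> maxF; right; apply: (inc_inj Fm); rewrite -maxF; apply/esym.
by case: (leP s t) => [st|/ltW ts]; [apply/max_idPr|apply/max_idPl]; rewrite Fm.
Qed.

Lemma isoscelesC r s t : isosceles r s t -> isosceles r t s.
Proof. by case=> [[-> rt]|<-]; [left|right; rewrite maxC]. Qed.

Lemma isosceles_rot r s t : isosceles r s t -> isosceles s t r.
Proof.
case=> [[<- rs]|<-]; first by right; apply/max_idPl/ltW.
case: ltgtP => [st|ts|->]; [by left|right|right; exact: maxxx].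
exact/max_idPr/ltW.
Qed.

End OrderedZmoduleTheory.

(** * Ends of concatenated sequences *)

Lemma sorted_cat_ends (T : Type) (e : rel T) (x0 : T) u v :
  ~~ nilp u -> ~~ nilp v ->
  sorted e (u ++ v) = [&& sorted e u, e (last x0 u) (head x0 v) & sorted e v].
Proof. by case: u v => [|x u] [|y v] //= _ _; rewrite cat_path. Qed.

Lemma cycle_ends (T : Type) (e : rel T) (x0 : T) w :
  ~~ nilp w -> cycle e w = sorted e w && e (last x0 w) (head x0 w).
Proof. by case: w => [|x w] //= _; rewrite rcons_path. Qed.

Lemma head_catl (T : Type) (x0 : T) u v :
  ~~ nilp u -> head x0 (u ++ v) = head x0 u.
Proof. by case: u. Qed.

Lemma last_catr (T : Type) (x0 : T) u v :
  ~~ nilp v -> last x0 (u ++ v) = last x0 v.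
Proof. by rewrite last_cat; case: v. Qed.

Lemma nilp_cat (T : Type) (u v : seq T) : nilp (u ++ v) = nilp u && nilp v.
Proof. by rewrite /nilp size_cat addn_eq0. Qed.

(** * Cyclically reduced words and conjugacy in the free group *)

Section CyclicallyReduced.
Variables (T : choiceType) (x0 : letter T).
Implicit Types (x y : letter T) (u v w s : seq (letter T)).

Lemma noncancelxx x : noncancel x x.
Proof. by case: x => t []; rewrite /noncancel /letter_inv xpair_eqE andbF. Qed.

Lemma noncancelV x y : noncancel (letter_inv y) (letter_inv x) = noncancel x y.
Proof. by rewrite /noncancel letter_invK eq_sym. Qed.

Lemma noncancelNV x y : noncancel x (letter_inv y) = (x != y).
Proof. by rewrite /noncancel letter_invK. Qed.

Lemma noncancelVN x y : noncancel (letter_inv x) y = (x != y).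
Proof. by rewrite /noncancel (inj_eq (can_inj (@letter_invK T))). Qed.

Lemma word_inv_cat u v : word_inv (u ++ v) = word_inv v ++ word_inv u.
Proof. by rewrite /word_inv map_cat rev_cat. Qed.

Lemma nilp_word_inv w : nilp (word_inv w) = nilp w.
Proof. by rewrite /nilp size_rev size_map. Qed.

Lemma head_word_inv w :
  ~~ nilp w -> head x0 (word_inv w) = letter_inv (last x0 w).
Proof.
by case: w => // x w _; rewrite lastI /word_inv map_rcons rev_rcons last_rcons.
Qed.

Lemma last_word_inv w :
  ~~ nilp w -> last x0 (word_inv w) = letter_inv (head x0 w).
Proof. by case: w => // x w _; rewrite /word_inv /= rev_cons last_rcons. Qed.

Lemma word_elt_inv w : word_elt (word_inv w) = (word_elt w)^-1%g.
Proof.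
apply: (mulIg (word_elt w)); rewrite -word_elt_cat mulVg.
by apply: val_inj; rewrite /= reduce_mulVw.
Qed.

Lemma word_elt_rot k w :
  exists h, word_elt (rot k w) = (h * word_elt w * h^-1)%g.
Proof.
exists (word_elt (take k w))^-1%g; rewrite -{3}(cat_take_drop k w) /rot.
by rewrite !word_elt_cat invgK mulKg.
Qed.

Lemma word_eltK (g : freegroup T) : word_elt (fg_word g) = g.
Proof. by case: g => w rw; apply: val_inj; rewrite /= reduce_id. Qed.

Lemma cyclically_reducedE w :
  cyclically_reduced w =
  [&& ~~ nilp w, reduced w & noncancel (last x0 w) (head x0 w)].
Proof.
rewrite /cyclically_reduced -size_eq0 -/(nilp w).
by case: (boolP (nilp w)) => //= w0; rewrite (cycle_ends _ x0).
Qed.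

Lemma cyclically_reduced_nil w : cyclically_reduced w -> ~~ nilp w.
Proof. by rewrite cyclically_reducedE => /and3P[]. Qed.

Lemma cyclically_reduced_reduced w : cyclically_reduced w -> reduced w.
Proof. by rewrite cyclically_reducedE => /and3P[]. Qed.

Lemma cyclically_reduced_ends w :
  cyclically_reduced w -> noncancel (last x0 w) (head x0 w).
Proof. by rewrite cyclically_reducedE => /and3P[]. Qed.

Lemma cyclically_reduced_cat u v : ~~ nilp u -> ~~ nilp v ->
  reduced u -> reduced v ->
  noncancel (last x0 u) (head x0 v) -> noncancel (last x0 v) (head x0 u) ->
  cyclically_reduced (u ++ v).
Proof.
move=> u0 v0 ru rv uv vu; rewrite cyclically_reducedE nilp_cat (negbTE u0) /=.
rewrite /reduced (sorted_cat_ends _ x0) // -!/(reduced _) ru rv uv.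
by rewrite head_catl // last_catr.
Qed.

Lemma cyclically_reduced_inv w :
  cyclically_reduced w -> cyclically_reduced (word_inv w).
Proof.
rewrite !cyclically_reducedE nilp_word_inv => /and3P[w0 /word_inv_reduced-> ew].
by rewrite w0 head_word_inv // last_word_inv // noncancelV.
Qed.

Lemma cyclically_reduced_rot k w :
  cyclically_reduced (rot k w) = cyclically_reduced w.
Proof. by rewrite /cyclically_reduced rot_cycle -!size_eq0 size_rot. Qed.

Lemma word_elt_cyclically_reduced_neq1 w :
  cyclically_reduced w -> word_elt w != 1%g.
Proof.
move=> cw; apply/eqP => /(congr1 (@fg_word T)) /=.
rewrite reduce_id ?cyclically_reduced_reduced // => w0.
by have := cyclically_reduced_nil cw; rewrite w0.
Qed.

(* The words u and s v s^-1 have disjoint axes, joined by the bridge s. *)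
Definition bridge u s v :=
  [&& ~~ nilp s, reduced s, noncancel (last x0 u) (head x0 s),
      noncancel (letter_inv (head x0 s)) (head x0 u),
      noncancel (last x0 s) (head x0 v) &
      noncancel (last x0 v) (letter_inv (last x0 s))].

Lemma reduced_conj s v : ~~ nilp s -> reduced s -> cyclically_reduced v ->
  noncancel (last x0 s) (head x0 v) ->
  noncancel (last x0 v) (letter_inv (last x0 s)) ->
  reduced (s ++ v ++ word_inv s).
Proof.
move=> s0 rs; rewrite cyclically_reducedE => /and3P[v0 rv _] sv vs.
rewrite /reduced (sorted_cat_ends _ x0) ?nilp_cat ?negb_and ?v0 //.
rewrite (sorted_cat_ends _ x0) ?nilp_word_inv //.
rewrite -!/(reduced _) rs rv (word_inv_reduced rs) head_word_inv // vs.
by rewrite head_catl // sv.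
Qed.

Lemma cyclically_reduced_bridge u s v :
  cyclically_reduced u -> cyclically_reduced v -> bridge u s v ->
  cyclically_reduced (u ++ s ++ v ++ word_inv s).
Proof.
move=> cu cv /and5P[s0 rs us su /andP[sv vs]].
have ns0 : ~~ nilp (word_inv s) by rewrite nilp_word_inv.
apply: cyclically_reduced_cat; rewrite ?nilp_cat ?negb_and ?s0 //.
- exact: cyclically_reduced_nil.
- exact: cyclically_reduced_reduced.
- exact: reduced_conj.
- by rewrite head_catl.
- by rewrite catA last_catr // last_word_inv.
Qed.

Lemma word_elt_conj s v :
  word_elt (s ++ v ++ word_inv s)
  = (word_elt s * word_elt v * (word_elt s)^-1)%g.
Proof. by rewrite !word_elt_cat word_elt_inv mulgA. Qed.

Lemma word_elt_rot1 x v :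
  word_elt (rot 1 (x :: v))
  = (word_elt [:: letter_inv x] * word_elt (x :: v)
      * (word_elt [:: letter_inv x])^-1)%g.
Proof.
rewrite rot1_cons -cats1 word_elt_cat -(cat1s x v) word_elt_cat.
by rewrite word_elt_letter_inv invgK mulKg.
Qed.

Lemma word_elt_rotr1 x v :
  word_elt (rotr 1 (rcons v x))
  = (word_elt [:: x] * word_elt (rcons v x) * (word_elt [:: x])^-1)%g.
Proof.
rewrite rotr1_rcons -cats1 word_elt_cat -(cat1s x v) word_elt_cat.
by rewrite !mulgA mulgK.
Qed.

(** If [x] cancels against the head of [v], or [x^-1] against its last letter, then conjugating [v]
    by [x] merely rotates it by one letter, and [x] is absorbed. *)
Lemma conj_shorten s x v : cyclically_reduced v ->
  ~~ (noncancel x (head x0 v) && noncancel (last x0 v) (letter_inv x)) ->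
  exists k, word_elt (rcons s x ++ v ++ word_inv (rcons s x))
    = word_elt (s ++ rot k v ++ word_inv s).
Proof.
move=> cv xv; suff [k kE] : exists k, word_elt (rot k v)
    = (word_elt [:: x] * word_elt v * (word_elt [:: x])^-1)%g.
  exists k; rewrite !word_elt_conj kE -cats1 word_elt_cat invgM.
  by rewrite !mulgA.
move: xv; rewrite negb_and noncancelNV /noncancel !negbK => /orP[]/eqP.
- case: v cv => //= y v _ ->; exists 1%N.
  exact: word_elt_rot1.
- case/lastP: v cv => // v y _; rewrite last_rcons => ->.
  by exists (size (rcons v x) - 1)%N; apply: word_elt_rotr1.
Qed.

Lemma rot_comp m n v : exists k, rot m (rot n v) = rot k v.
Proof.
by rewrite rot_minn (rot_minn n) size_rot rot_add_mod ?geq_minr //; eexists.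
Qed.

(** Induction on the reduced word of the conjugator, from its inner end: a last letter that cancels
    into [v] is absorbed by a rotation, and one that does not cancel leads to a contradiction. *)
Lemma cyclically_reduced_conj h v w :
  cyclically_reduced v -> cyclically_reduced w ->
  word_elt w = (h * word_elt v * h^-1)%g -> exists k, w = rot k v.
Proof.
move=> + cw; rewrite -(word_eltK h) -word_elt_conj; case: h => s /=.
elim/last_ind: s v => [|s x IHs] v rs cv.
  move=> /(congr1 (@fg_word T)) /=; rewrite cats0.
  rewrite !reduce_id ?cyclically_reduced_reduced // => ->.
  by exists 0%N; rewrite rot0.
have [xv|/(conj_shorten s cv)[k ->]] := boolP (noncancel x (head x0 v)
    && noncancel (last x0 v) (letter_inv x)).
  have s0 : ~~ nilp (rcons s x) by rewrite /nilp size_rcons.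
  case/andP: xv; rewrite -{1 2}(last_rcons x0 s x) => sv vs.
  have rsv := reduced_conj s0 rs cv sv vs.
  move=> /(congr1 (@fg_word T)) /=.
  rewrite (reduce_id rsv) reduce_id ?cyclically_reduced_reduced // => wE.
  have ns0 : ~~ nilp (word_inv (rcons s x)) by rewrite nilp_word_inv.
  (* Without cancellation, [w] would begin with the head of the conjugator and end with the inverse
     of that letter. *)
  have := cyclically_reduced_ends cw.
  rewrite wE head_catl // catA last_catr // last_word_inv //.
  by rewrite /noncancel eqxx.
have rs' : reduced s.
  by move: rs; rewrite /reduced -cats1 => /cat_sorted2[].
move=> /IHs[]; rewrite ?cyclically_reduced_rot // => m ->.
exact: rot_comp.
Qed.

(** The cancelling pair is either inside the word or formed by its last and first letters; a
    rotation brings it to the front in both cases. *)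
Lemma rot_cancel w : ~~ nilp w -> ~~ cyclically_reduced w ->
  exists k, exists x v, rot k w = x :: letter_inv x :: v.
Proof.
move=> w0; rewrite cyclically_reducedE w0 /= negb_and.
have [rw|nrw _] := boolP (reduced w) => /=.
  rewrite /noncancel negbK; case: w w0 rw => // x s _ rw.
  case/lastP: s rw => [|s y] _; rewrite /= ?last_rcons => /eqP xy.
    by have := noncancelxx x; rewrite /noncancel -xy eqxx.
  rewrite xy.
  exists (size (x :: rcons s (letter_inv x)) - 1)%N, (letter_inv x), s.
  by rewrite letter_invK -rcons_cons -[rot _ _]/(rotr 1 _) rotr1_rcons.
suff [u [x [v ->]]] : exists u x v, w = u ++ x :: letter_inv x :: v.
  by exists (size u); rewrite rot_size_cat; do 2!eexists.
elim: w {w0} nrw => // x [|y w] // IHw.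
rewrite /reduced /= negb_and => /orP[|/IHw[u [z [v ->]]]].
  rewrite negbK => /eqP->; exists [::], (letter_inv y), w.
  by rewrite letter_invK.
by exists (x :: u), z, v.
Qed.

End CyclicallyReduced.

(** * Weights along words and around cycles *)

Section CyclicWeight.
Variable L : orderedZmodType.
Implicit Types (f : Sigma -> Sigma -> L) (x y : Sigma) (u v w : seq Sigma).

Definition path_weight f w : L :=
  \sum_(i < (size w).-1) f (nth la w i) (nth la w i.+1).

Lemma path_weight_cons f x y w :
  path_weight f (x :: y :: w) = f x y + path_weight f (y :: w).
Proof. exact: big_ord_recl. Qed.

Lemma path_weight1 f x : path_weight f [:: x] = 0.
Proof. exact: big_ord0. Qed.

Lemma path_weight_cat f u v : ~~ nilp u -> ~~ nilp v ->
  path_weight f (u ++ v)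
  = path_weight f u + f (last la u) (head la v) + path_weight f v.
Proof.
case: v => // y v u0 _; elim: u u0 => // x [|z u] IHu _ /=.
  by rewrite path_weight_cons path_weight1 add0r.
by rewrite !path_weight_cons IHu // !addrA.
Qed.

Lemma path_weight_inv f w :
  (forall x y, f x y = f (letter_inv y) (letter_inv x)) ->
  path_weight f (word_inv w) = path_weight f w.
Proof.
move=> fV; elim: w => // x [|y w] IHw; first by rewrite !path_weight1.
rewrite -cat1s word_inv_cat path_weight_cat ?nilp_word_inv // IHw.
by rewrite path_weight_cons last_word_inv //= -fV path_weight1 addr0 addrC.
Qed.

Lemma cyclic_weight_rot f k w : cyclic_weight f (rot k w) = cyclic_weight f w.
Proof.
rewrite -{2}(cat_take_drop k w) /rot.
case: (take k w) (drop k w) => [|x u] [|y v]; rewrite ?cats0 //.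
rewrite /cyclic_weight -!/(path_weight _ _) !path_weight_cat // !last_cat /=.
by rewrite -addrA addrC addrA.
Qed.

Lemma cyclic_weight_inv f w :
  (forall x y, f x y = f (letter_inv y) (letter_inv x)) -> ~~ nilp w ->
  cyclic_weight f (word_inv w) = cyclic_weight f w.
Proof.
move=> fV w0; rewrite /cyclic_weight -!/(path_weight _ _) path_weight_inv //.
by rewrite head_word_inv ?last_word_inv // -fV.
Qed.

Section Halving.
Variables (c : Sigma -> L) (k : Sigma -> Sigma -> L) (f : Sigma -> Sigma -> L).
Hypothesis fE : forall x y, f x y = c x + c y + k x y *+ 2.

(** Each interior letter contributes its [c] twice; the two correction terms account for the end
    letters, which contribute it only once. *)
Lemma path_weight_half w :
  path_weight f w + c (head la w)
  = path_weight (fun x y => c x + k x y) w *+ 2 + c (last la w).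
Proof.
elim: w => [|x [|y w] IHw]; rewrite ?path_weight1 ?mul0rn //.
  by rewrite /path_weight !big_ord0 mul0rn.
rewrite !path_weight_cons mulrnDl -[RHS]addrA -IHw fE !mulrnDl mulr2n /=.
by rewrite !addrA [LHS](ACl (1*6*3*4*5*2))%AC.
Qed.

Lemma cyclic_weight_half w :
  cyclic_weight f w = cyclic_weight (fun x y => c x + k x y) w *+ 2.
Proof.
rewrite /cyclic_weight -!/(path_weight _ _) fE -!addrA (addrCA (c _)) !addrA.
by rewrite path_weight_half !mulrnDl !addrA -(addrA _ (c _) (c _)) -mulr2n.
Qed.

End Halving.

Section Cancellation.
Variable f : Sigma -> Sigma -> L.
Hypothesis f_cancel : forall x, f x (letter_inv x) = 0.
Hypothesis f_triangle : forall x y z, f y z <= f y x + f (letter_inv x) z.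

(** Dropping [x x^-1] replaces the two turns through [x] by a single turn, so this is the triangle
    inequality. *)
Lemma cyclic_weight_cancel x v : ~~ nilp v ->
  cyclic_weight f v <= cyclic_weight f (x :: letter_inv x :: v).
Proof.
case: v => // y v _; rewrite /cyclic_weight -!/(path_weight _ _).
rewrite !path_weight_cons f_cancel add0r -addrA addrCA omod_leD2l addrC.
exact: f_triangle.
Qed.

(** Cyclic cancellation is iterated until it stops. The word is returned as data, so that
    [length_exists] can build a function from it. *)
Lemma cyclic_representative w : {v |
  exists h, word_elt v = (h * word_elt w * h^-1)%g &
  v = [::] \/ cyclically_reduced v /\ cyclic_weight f v <= cyclic_weight f w}.
Proof.
have [n] := ubnP (size w); elim: n w => // n IHn w szw.
have [w0|w0] := boolP (nilp w).
  by exists [::]; [exists 1%g; rewrite (nilP w0) invg1 mulg1 mul1g|left].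
have [cw|ncw] := boolP (cyclically_reduced w).
  by exists w; [exists 1%g; rewrite mul1g invg1 mulg1|right].
pose cancels k := if rot k w is x :: y :: _ then y == letter_inv x else false.
have exk : exists k, cancels k.
  have [k [x [v wE]]] := rot_cancel la w0 ncw.
  by exists k; rewrite /cancels wE eqxx.
have := xchooseP exk; move: (xchoose exk) => k; rewrite /cancels.
case wE: (rot k w) => [|x [|y v]] // /eqP yE; rewrite {y}yE in wE.
have [|v' v'J v'W] := IHn v.
  have := congr1 size wE; rewrite size_rot /= => szE.
  by move: szw; rewrite szE ltnS; apply: ltnW.
have vE : word_elt v = word_elt (rot k w).
  rewrite wE -cat1s -[letter_inv x :: v]cat1s !word_elt_cat word_elt_letter_inv.
  by rewrite mulVKg.
exists v'.
  have [h hE] := word_elt_rot k w; have [h' h'E] := v'J.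
  by exists (h' * h)%g; rewrite h'E vE hE invgM !mulgA.
(* [cyclic_weight_cancel] excludes an empty [v], whose cyclic weight is the default value [f la la].
   Here [v'] must be empty too, since a cyclically reduced word is nontrivial in the group. *)
have [v0|v0] := boolP (nilp v).
  case: v'W => [|[cv' _]]; [by left|].
  have [h' h'E] := v'J; have := word_elt_cyclically_reduced_neq1 la cv'.
  rewrite h'E (nilP v0) (_ : word_elt [::] = 1%g) // mulg1 mulgV.
  by rewrite eqxx.
case: v'W => [|[cv' v'W]]; [by left|right; split=> //].
apply: le_trans v'W _; rewrite -(cyclic_weight_rot f k w) wE.
exact: cyclic_weight_cancel.
Qed.

End Cancellation.
End CyclicWeight.

(** * Turn weights on the four directions at a vertex *)

Section Turns.
Variables (L : orderedZmodType) (alpha beta p q : L).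
Variable f : Sigma -> Sigma -> L.
Implicit Types x y z t : Sigma.

Hypothesis f_weight :
  is_weight alpha beta (alpha + beta + p *+ 2) (alpha + beta + q *+ 2) f.
Hypotheses (alpha_gt0 : 0 < alpha) (beta_gt0 : 0 < beta).
Hypotheses (alphap_gt0 : 0 < alpha + p) (alphaq_gt0 : 0 < alpha + q).
Hypotheses (betap_gt0 : 0 < beta + p) (betaq_gt0 : 0 < beta + q).
Hypothesis pq_isosceles : isosceles 0 p q.

Definition arm x : L := if x.1 then beta else alpha.

(** Half the deviation of [f x y] from [arm x + arm y]; the value [- arm x] accounts for
    [f x (letter_inv x) = 0]. *)
Definition excess x y : L :=
  if x.1 == y.1 then if x.2 == y.2 then 0 else - arm x
  else if x.2 == y.2 then p else q.

Lemma arm_inv x : arm (letter_inv x) = arm x. Proof. by []. Qed.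

Lemma weight_excess x y : f x y = arm x + arm y + excess x y *+ 2.
Proof.
have /is_weightP-> := f_weight; case: x y => [[] xb] [[] yb];
  rewrite /excess /arm /= ?(addrC beta alpha) //;
  by case: eqP => _; rewrite ?mul0rn ?addr0 ?mulr2n // addrACA subrr addr0.
Qed.

Lemma weight_ge0 x y : 0 <= f x y.
Proof.
(* The sum regroups as [(alpha + r) + (beta + r)]. *)
have gt0 r : 0 < alpha + r -> 0 < beta + r -> 0 <= alpha + beta + r *+ 2.
  by move=> ar br; rewrite mulr2n addrACA omod_addr_ge0 // ltW.
have /is_weightP-> := f_weight.
by do 4?case: ifP => _ //; rewrite ?gt0 // mulr2n omod_addr_ge0 ?ltW.
Qed.

(** Among the three distinct directions [y^-1], [x], [z] exactly two are mutually inverse. That pair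
    has excess [0], and the other two pairs have excesses [p] and [q]. *)
Lemma excess_triple x y z :
    noncancel y z -> noncancel y x -> noncancel (letter_inv x) z ->
  exists2 m, [\/ m = p + q, m = p - q | m = q - p] &
    excess y x + excess (letter_inv x) z = excess y z + m.
Proof.
move: x y z => [[] []] [[] []] [[] []] //= _ _ _; rewrite /excess /=;
  first [ by exists (p + q); [constructor 1|rewrite ?addr0 ?add0r // addrC]
    | by exists (p - q); [constructor 2|rewrite ?addr0 ?add0r // addrC subrK]
    | by exists (q - p); [constructor 3|rewrite ?addr0 ?add0r // addrC subrK]].
Qed.

(* [arm x + m] is the Gromov product at x of y^-1 and z for the metric d; the *)
(* parity statement makes the length of a bridge divisible by 2.              *)
Lemma weight_triple x y z :
    noncancel y z -> noncancel y x -> noncancel (letter_inv x) z ->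
  exists m, [/\ 0 < arm x + m, in_double (m - (p + q)) &
    f y x + f (letter_inv x) z = f y z + (arm x + m) *+ 2].
Proof.
move=> yz yx xz; have [m mE kE] := excess_triple yz yx xz.
have xpq : 0 < arm x + p /\ 0 < arm x + q by rewrite /arm; case: ifP.
have x0 : 0 < arm x by rewrite /arm; case: ifP.
exists m; split.
(* In each of these cases [arm x + m] is [arm x], [arm x + p] or [arm x + q], possibly plus a
   nonnegative term. *)
- have pqE : (p = q /\ 0 < q) \/ (p = 0 /\ q <= 0) \/ (q = 0 /\ p <= 0).
    case: pq_isosceles => [|]; first by left.
    by case: (leP p q) => [le_pq pq0|/ltW le_pq pq0]; right; [right|left];
      rewrite -pq0.
  have oppr_ge0 (r : L) : r <= 0 -> 0 <= - r.
    by move=> r0; rewrite -(omod_leD2l r) addr0 subrr.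
  have [xp xq] := xpq.
  case: mE => ->; case: pqE => [[-> q0]|[[p0 q0]|[q0 p0]]];
    rewrite ?p0 ?q0 ?subr0 ?sub0r ?addr0 ?add0r ?subrr ?addr0 //;
    first [ by rewrite addrA omod_addr_gt0 // ltW
          | by apply: omod_addr_gt0 x0 _; apply: oppr_ge0 ].
- have [->|->|->] := mE.
  + by exists 0; rewrite mul0rn subrr.
  + by exists (- q); rewrite opprD addrACA subrr add0r mulr2n.
  + by exists (- p); rewrite (addrC p) opprD addrACA subrr add0r mulr2n.
rewrite !weight_excess arm_inv [LHS](AC (3*3) ((1*5)*(2*4)*(3*6)))%AC /=.
rewrite -!mulrnDl kE !mulrnDl -mulr2n.
by rewrite [RHS](AC (3*2) ((1*2)*4*(3*5)))%AC.
Qed.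

Lemma weight_triangle x y z : f y z <= f y x + f (letter_inv x) z.
Proof.
have f0 x' : f (letter_inv x') x' = 0.
  by rewrite -{2}(letter_invK x') (weight_V f_weight).
have [yz|] := boolP (noncancel y z); last first.
  rewrite negbK => /eqP->; rewrite f0.
  by rewrite omod_addr_ge0 ?weight_ge0.
have [yx|] := boolP (noncancel y x); last first.
  by rewrite negbK => /eqP->; rewrite f0 add0r.
have [xz|] := boolP (noncancel (letter_inv x) z); last first.
  by rewrite negbK => /eqP/(can_inj (@letter_invK _))->; rewrite f0 addr0.
have [m [/ltW m0 _ ->]] := weight_triple yz yx xz.
by rewrite -{1}[f y z]addr0 omod_leD2l mulr2n omod_addr_ge0.
Qed.

(** The hypotheses make [y^-1], [x], [z^-1], [t] the four directions. In each of the three ways to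
    split them into two pairs, both pairs have the same excess, and the three excesses are [0], [p],
    [q] in some order. So each sum is the total of the arms plus four times an excess. *)
Lemma weight_four_ends x y z t :
    [/\ noncancel y x, noncancel z t & noncancel y t] ->
    [/\ noncancel z x, noncancel y (letter_inv z) &
        noncancel (letter_inv t) x] ->
  isosceles (f y x + f z t) (f y t + f z x)
            (f y (letter_inv z) + f (letter_inv t) x) /\
  exists m, f y t + f z x = f y x + f z t + m *+ 2 *+ 2.
Proof.
move=> h1 h2.
suff [r [s [i [iso [kr kr' ks] [ks' ki ki']]]]] : exists r s i,
    [/\ isosceles r s i,
       [/\ excess y x = r, excess z t = r & excess y t = s] &
       [/\ excess z x = s, excess y (letter_inv z) = i &
           excess (letter_inv t) x = i]].
  pose C := arm y + arm x + arm z + arm t.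
  pose F u := C + u *+ 2 *+ 2.
  have -> : f y x + f z t = F r.
    rewrite /F !weight_excess kr kr' (mulr2n (_ *+ 2)).
    by rewrite [LHS](AC (3*3) ((1*2*4*5)*(3*6)))%AC.
  have -> : f y t + f z x = F s.
    rewrite /F !weight_excess ks ks' (mulr2n (_ *+ 2)).
    by rewrite [LHS](AC (3*3) ((1*5*4*2)*(3*6)))%AC.
  have -> : f y (letter_inv z) + f (letter_inv t) x = F i.
    rewrite /F !weight_excess ki ki' !arm_inv (mulr2n (_ *+ 2)).
    by rewrite [LHS](AC (3*3) ((1*5*2*4)*(3*6)))%AC.
  split; last first.
    by exists (s - r); rewrite /F -[RHS]addrA -!mulrnDl (addrC r) subrK.
  apply: isosceles_mono iso => u v.
  by rewrite /F omod_leD2l !omod_le_double.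
have iso1 := pq_isosceles.
have iso2 := isosceles_rot iso1; have iso3 := isosceles_rot iso2.
have iso4 := isoscelesC iso1; have iso5 := isoscelesC iso2.
have iso6 := isoscelesC iso3.
case: h1 h2 => yx zt yt [zx yz tx]; move: x y z t yx zt yt zx yz tx.
move=> [[] []] [[] []] [[] []] [[] []] //= _ _ _ _ _ _; rewrite /excess /=;
  do 3!eexists; (split; [|split; reflexivity|split; reflexivity]);
  first [exact: iso1 | exact: iso2 | exact: iso3
       | exact: iso4 | exact: iso5 | exact: iso6].
Qed.

(** * Existence and uniqueness of the length *)

Lemma cyclic_rep w : {v |
  exists h, word_elt v = (h * word_elt w * h^-1)%g &
  v = [::] \/ cyclically_reduced v /\ cyclic_weight f v <= cyclic_weight f w}.
Proof. exact: cyclic_representative (weight_V f_weight) weight_triangle w. Qed.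

Lemma cyclic_rep_neq1 (g : freegroup bool) : g != 1%g ->
  exists2 v, cyclically_reduced v & exists h, word_elt v = (h * g * h^-1)%g.
Proof.
move=> g1; have [v [h vE] [v0|[cv _]]] := cyclic_rep (fg_word g); last first.
  by exists v => //; exists h; rewrite vE word_eltK.
case/eqP: g1; rewrite word_eltK v0 in vE.
by apply: (mulgI h); apply: (mulIg h^-1%g); rewrite -vE mulg1 mulgV.
Qed.

Lemma length_exists : exists l, is_length f l.
Proof.
pose half w := cyclic_weight (fun x y => arm x + excess x y) w.
pose l (g : freegroup bool) :=
  if g == 1%g then 0 else half (s2val (cyclic_rep (fg_word g))).
exists l; split=> [|g w g1 cw [h wE]]; first by rewrite /l eqxx.
rewrite /l (negbTE g1) -(cyclic_weight_half weight_excess).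
case: cyclic_rep => v /= [h' vE] [v0|[cv _]].
  case/eqP: g1; rewrite word_eltK v0 in vE.
  by apply: (mulgI h'); apply: (mulIg h'^-1%g); rewrite -vE mulg1 mulgV.
rewrite word_eltK in vE.
have [|k ->] := @cyclically_reduced_conj _ la (h * h'^-1)%g v w cv cw.
  by rewrite vE wE invgM invgK !mulgA !mulgVK.
by rewrite cyclic_weight_rot.
Qed.

Lemma length_unique (l l' : freegroup bool -> L) :
  is_length f l -> is_length f l' -> l' =1 l.
Proof.
move=> [l1 lE] [l'1 l'E] g; have [->|g1] := eqVneq g 1%g; first by rewrite l1.
have [v cv vg] := cyclic_rep_neq1 g1.
by apply: omod_double_inj; rewrite /= (lE g v) // (l'E g v).
Qed.

(** * Invariance, sign and upper bound of the length *)

Variables (l : freegroup bool -> L) (l_length : is_length f l).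
Implicit Types (g h : freegroup bool) (s u v w : seq Sigma).

Lemma length1 : l 1%g = 0. Proof. by case: l_length. Qed.

Lemma length_conjE g h w : cyclically_reduced w ->
  word_elt w = (h * g * h^-1)%g -> l g *+ 2 = cyclic_weight f w.
Proof.
move=> cw wE; case: l_length => _; apply=> //; last by exists h.
apply/eqP => g1; have := word_elt_cyclically_reduced_neq1 la cw.
by rewrite wE g1 mulg1 mulgV eqxx.
Qed.

Lemma lengthE w :
  cyclically_reduced w -> l (word_elt w) *+ 2 = cyclic_weight f w.
Proof.
move=> cw; apply: (@length_conjE _ 1%g) => //.
by rewrite mul1g invg1 mulg1.
Qed.

Lemma length_conj g h : l (h * g * h^-1)%g = l g.
Proof.
have [->|g1] := eqVneq g 1%g; first by rewrite mulg1 mulgV.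
have [v cv [k vE]] := cyclic_rep_neq1 g1; apply: omod_double_inj => /=.
rewrite (length_conjE cv vE); apply: (@length_conjE _ (k * h^-1)%g) => //.
by rewrite vE invgM invgK !mulgA !mulgVK.
Qed.

Lemma length_inv g : l g^-1%g = l g.
Proof.
have [->|g1] := eqVneq g 1%g; first by rewrite invg1.
have [v cv [k vE]] := cyclic_rep_neq1 g1; apply: omod_double_inj => /=.
rewrite (length_conjE cv vE).
rewrite (@length_conjE _ k (word_inv v)) ?(cyclically_reduced_inv la cv) //.
  rewrite cyclic_weight_inv ?(cyclically_reduced_nil la cv) //.
  exact: weight_inv f_weight.
by rewrite word_elt_inv vE !invgM invgK mulgA.
Qed.

Lemma length_comm g h : l (g * h)%g = l (h * g)%g.
Proof. by rewrite -(length_conj (g * h)%g h) !mulgA mulgK. Qed.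

Lemma path_weight_ge0 w : 0 <= path_weight f w.
Proof.
rewrite /path_weight; elim/big_ind: _ => // *; last exact: weight_ge0.
exact: omod_addr_ge0.
Qed.

Lemma cyclic_weight_ge0 w : 0 <= cyclic_weight f w.
Proof. by rewrite omod_addr_ge0 ?path_weight_ge0 ?weight_ge0. Qed.

Lemma length_ge0 g : 0 <= l g.
Proof.
have [->|g1] := eqVneq g 1%g; first by rewrite length1.
have [v cv [k vE]] := cyclic_rep_neq1 g1.
by rewrite -omod_le_double mul0rn (length_conjE cv vE) cyclic_weight_ge0.
Qed.

Lemma length_le w : l (word_elt w) *+ 2 <= cyclic_weight f w.
Proof.
have [v [h vE] [v0|[cv vw]]] := cyclic_rep w.
  by rewrite -(length_conj _ h) -vE v0 length1 mul0rn cyclic_weight_ge0.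
by rewrite (length_conjE cv vE).
Qed.

(** * Pairs of nontrivial elements, by the position of their axes *)

(** The alternative of (A3), which also yields (A2), together with the parity of (A0). It is proved
    for all nontrivial pairs. *)
Definition compatible g h :=
  isosceles (l g + l h) (l (g * h)%g) (l (g * h^-1)%g) /\
  (l g + l h < l (g * h)%g -> in_double (l (g * h)%g - l g - l h)).

Lemma compatible_invr g h : compatible g h -> compatible g h^-1%g.
Proof.
move=> [iso dbl]; rewrite /compatible invgK length_inv; split.
  exact: isoscelesC.
case: iso => [[<- _]|<-] //.
by rewrite ltNge le_max lexx orbT.
Qed.

Lemma compatible_invl g h : compatible g h -> compatible g^-1%g h.
Proof.
have E : l (g^-1 * h)%g = l (g * h^-1)%g.
  by rewrite -length_inv invgM invgK length_comm.
have E' : l (g^-1 * h^-1)%g = l (g * h)%g.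
  by rewrite -length_inv invgM !invgK length_comm.
move=> /compatible_invr; rewrite /compatible.
by rewrite !length_inv invgK E E'.
Qed.

Lemma compatible_conj k g h :
  compatible (k * g * k^-1)%g (k * h * k^-1)%g -> compatible g h.
Proof.
have E h' : (k * g * k^-1 * (k * h' * k^-1) = k * (g * h') * k^-1)%g.
  by rewrite !mulgA mulgVK.
have V : ((k * h * k^-1)^-1 = k * h^-1 * k^-1)%g by rewrite !invgM invgK mulgA.
by rewrite /compatible V !E !length_conj.
Qed.

(** The axes share the edge of the common head. In [u v] nothing cancels and the turns at the two
    seams are those of [u] and [v] exchanged, so lengths add. *)
Lemma compatible_eq_heads u v : cyclically_reduced u -> cyclically_reduced v ->
  head la u = head la v -> compatible (word_elt u) (word_elt v).
Proof.
move=> cu cv uv.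
have [u0 v0] := (cyclically_reduced_nil la cu, cyclically_reduced_nil la cv).
suff [E le] : l (word_elt u * word_elt v)%g = l (word_elt u) + l (word_elt v) /\
    l (word_elt u * (word_elt v)^-1)%g <= l (word_elt u) + l (word_elt v).
  split; last by rewrite E ltxx.
  by right; rewrite E; apply/max_idPl.
split.
  have cuv : cyclically_reduced (u ++ v).
    apply: (cyclically_reduced_cat (x0 := la)) => //.
    - exact: (cyclically_reduced_reduced la).
    - exact: (cyclically_reduced_reduced la).
    - by rewrite -uv cyclically_reduced_ends.
    - by rewrite uv cyclically_reduced_ends.
  apply: omod_double_inj => /=; rewrite mulrnDl -word_elt_cat !lengthE //.
  rewrite /cyclic_weight -!/(path_weight _ _) path_weight_cat //.
  rewrite head_catl // last_catr // uv.
  by rewrite [LHS](AC (3*1) ((1*2)*(3*4)))%AC.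
rewrite -omod_le_double mulrnDl -word_elt_inv -word_elt_cat.
(* The word [u v^-1] is not cyclically reduced: its closing turn cancels and weighs [0]. Its other
   seam is bounded by the triangle inequality through the common head. *)
apply: le_trans (length_le _) _; rewrite !lengthE //.
have fV := weight_inv f_weight.
have nv0 : ~~ nilp (word_inv v) by rewrite nilp_word_inv.
rewrite /cyclic_weight -!/(path_weight _ _) path_weight_cat //.
rewrite head_catl // last_catr // path_weight_inv //
  head_word_inv // last_word_inv // uv.
have -> : f (letter_inv (head la v)) (head la v) = 0.
  by rewrite -{2}(letter_invK (head la v)) (weight_V f_weight).
rewrite addr0 addrAC [X in _ <= X]addrACA omod_leD2l.
by rewrite (fV (last la v)) weight_triangle.
Qed.

(** The axes meet in one vertex and leave it in four distinct directions. Up to the common term [D],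
    the doubles of the three quantities compared are the three sums of [weight_four_ends]. *)
Lemma compatible_four_heads u v :
  cyclically_reduced u -> cyclically_reduced v ->
  [/\ head la u != head la v, head la u != letter_inv (last la v),
      letter_inv (last la u) != head la v & last la u != last la v] ->
  compatible (word_elt u) (word_elt v).
Proof.
move=> cu cv [huv hulv luhv luv].
have fV := weight_inv f_weight.
have [u0 v0] := (cyclically_reduced_nil la cu, cyclically_reduced_nil la cv).
have nv0 : ~~ nilp (word_inv v) by rewrite nilp_word_inv.
have [ru rv] :=
  (cyclically_reduced_reduced la cu, cyclically_reduced_reduced la cv).
have [nu nv] := (cyclically_reduced_ends la cu, cyclically_reduced_ends la cv).
have nuv : noncancel (last la u) (head la v).
  by rewrite /noncancel -(inj_eq (can_inj (@letter_invK _))) letter_invK.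
have nuV : noncancel (last la u) (letter_inv (last la v)).
  by rewrite noncancelNV.
have nVu : noncancel (letter_inv (head la v)) (head la u).
  by rewrite noncancelVN eq_sym.
have nvu : noncancel (last la v) (head la u).
  by rewrite -noncancelV noncancelVN.
have cuv : cyclically_reduced (u ++ v) by apply: cyclically_reduced_cat nvu.
have cuV : cyclically_reduced (u ++ word_inv v).
  apply: (cyclically_reduced_cat (x0 := la)) => //.
    exact: word_inv_reduced.
    by rewrite head_word_inv.
  by rewrite last_word_inv.
have [iso [m mE]] := weight_four_ends (And3 nu nv nuv) (And3 nvu nuV nVu).
pose D := path_weight f u + path_weight f v.
have lD : (l (word_elt u) + l (word_elt v)) *+ 2
    = D + (f (last la u) (head la u) + f (last la v) (head la v)).
  rewrite mulrnDl !lengthE // /cyclic_weight -!/(path_weight _ _).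
  by rewrite addrACA.
have luv_D : l (word_elt u * word_elt v)%g *+ 2
    = D + (f (last la u) (head la v) + f (last la v) (head la u)).
  rewrite -word_elt_cat lengthE // /cyclic_weight -/(path_weight _ _).
  rewrite path_weight_cat // head_catl // last_catr //.
  by rewrite [LHS](ACl (1*3*(2*4)))%AC.
have luV_D : l (word_elt u * (word_elt v)^-1)%g *+ 2
    = D + (f (last la u) (letter_inv (last la v))
           + f (letter_inv (head la v)) (head la u)).
  rewrite -word_elt_inv -word_elt_cat lengthE // /cyclic_weight.
  rewrite -/(path_weight _ _) path_weight_cat // head_catl // last_catr //
    path_weight_inv //.
  by rewrite head_word_inv // last_word_inv // [LHS](ACl (1*3*(2*4)))%AC.
split.
  apply: (isosceles_inv_mono (@omod_le_double L)); rewrite lD luv_D luV_D.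
  exact: isosceles_mono (omod_leD2l D) iso.
move=> _; exists m; suff -> : l (word_elt u * word_elt v)%g
    = l (word_elt u) + l (word_elt v) + m *+ 2.
  by rewrite -addrA -opprD addrAC subrr add0r.
by apply: omod_double_inj => /=; rewrite luv_D mE addrA -lD -mulrnDl.
Qed.

Lemma cyclic_weight_bridge u s v : ~~ nilp u -> ~~ nilp s -> ~~ nilp v ->
  cyclic_weight f (u ++ s ++ v ++ word_inv s)
  = path_weight f u + path_weight f v + path_weight f s *+ 2
    + (f (last la u) (head la s) + f (letter_inv (head la s)) (head la u))
    + (f (last la v) (letter_inv (last la s)) + f (last la s) (head la v)).
Proof.
move=> u0 s0 v0; have fV := weight_inv f_weight.
have ns0 : ~~ nilp (word_inv s) by rewrite nilp_word_inv.
rewrite /cyclic_weight -/(path_weight _ _).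
rewrite !path_weight_cat ?nilp_cat ?negb_and ?s0 ?v0 ?ns0 //
  !head_catl // !last_catr //;
  rewrite ?nilp_cat ?negb_and ?s0 ?v0 ?ns0 ?orbT //.
rewrite path_weight_inv // head_word_inv // last_word_inv // !addrA.
by rewrite [LHS](ACl (1*5*3*7*2*8*6*4))%AC.
Qed.

Lemma compatible_bridge u s v : cyclically_reduced u -> cyclically_reduced v ->
  bridge la u s v -> compatible (word_elt u) (word_elt (s ++ v ++ word_inv s)).
Proof.
move=> cu cv br; have fV := weight_inv f_weight.
have [u0 v0] := (cyclically_reduced_nil la cu, cyclically_reduced_nil la cv).
have [s0 rs us su /andP[sv vs]] := and5P br.
have cvV := cyclically_reduced_inv la cv.
have brV : bridge la u s (word_inv v).
  rewrite /bridge s0 rs us su /= head_word_inv // last_word_inv //.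
  by rewrite noncancelV sv noncancelNV eq_sym -noncancelNV vs.
have c1 := cyclically_reduced_bridge cu cv br.
have c2 := cyclically_reduced_bridge cu cvV brV.
have [nu nv] := (cyclically_reduced_ends la cu, cyclically_reduced_ends la cv).
have [m [m0 dm mE]] := weight_triple nu us su.
have [|m' [m'0 dm' m'E]] := weight_triple nv vs; first by rewrite letter_invK.
rewrite letter_invK in m'E; rewrite arm_inv in m'0 m'E.
pose E := path_weight f s + (arm (head la s) + m) + (arm (last la s) + m').
have l1 : l (word_elt u * word_elt (s ++ v ++ word_inv s))%g
    = l (word_elt u) + l (word_elt v) + E.
  apply: omod_double_inj; rewrite /= (mulrnDl 2 _ E) (mulrnDl 2 (l _)).
  rewrite -word_elt_cat !lengthE // cyclic_weight_bridge // mE m'E.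
  rewrite /cyclic_weight -!/(path_weight _ _).
  by rewrite [LHS](AC (3*2*2) ((1*4)*(2*6)*(3*5*7)))%AC /= -!mulrnDl.
have l2 : l (word_elt u * (word_elt (s ++ v ++ word_inv s))^-1)%g
    = l (word_elt u * word_elt (s ++ v ++ word_inv s))%g.
  rewrite -word_elt_inv !word_inv_cat word_invK -catA.
  apply: omod_double_inj => /=; rewrite -!word_elt_cat !lengthE //.
  rewrite !cyclic_weight_bridge ?nilp_word_inv // path_weight_inv //.
  rewrite head_word_inv // last_word_inv // -fV.
  rewrite (fV (last la s) (letter_inv _)) letter_invK.
  by rewrite (addrC (f (last la s) _)).
have ls : l (word_elt (s ++ v ++ word_inv s)) = l (word_elt v).
  by rewrite word_elt_conj length_conj.
have E0 : 0 < E.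
  rewrite /E -addrA addrC; apply: omod_addr_gt0 (path_weight_ge0 s).
  exact: omod_addr_gt0 m0 (ltW m'0).
split.
  by left; rewrite l2 ls l1; split=> //; rewrite -omod_sub_gt0 addrC addKr.
move=> _; rewrite ls l1 -addrA -opprD addrAC subrr add0r.
(* [E] is a double: [m] and [m'] are both congruent to [p + q] modulo doubles, and [path_weight f s]
   is congruent to the sum of the arms of its end letters by [path_weight_half]. *)
case: dm dm' => d /eqP; rewrite subr_eq => /eqP dE [d' /eqP].
rewrite subr_eq => /eqP d'E; rewrite /E dE d'E; set r := p + q.
rewrite [X in in_double X](AC (1*(1*2)*(1*2)) ((1*2)*5*3*6*(4*7)))%AC /=.
rewrite (path_weight_half weight_excess) -(addrA _ (arm _) (arm _)).
rewrite -(mulr2n (arm _)) -(mulr2n r) -!mulrnDl.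
by eexists.
Qed.

(** Induction on the length of [s]: if [s] is nonempty but not a bridge, one of its end letters
    cancels into [u] or [v] and is absorbed by rotating that word. *)
Lemma compatible_words u s v : cyclically_reduced u -> cyclically_reduced v ->
  reduced s -> compatible (word_elt u) (word_elt (s ++ v ++ word_inv s)).
Proof.
have [n] := ubnP (size s); elim: n s u v => // n IHn s u v szs cu cv rs.
have [s0|s0] := boolP (nilp s).
  rewrite (nilP s0) cats0 /=.
  have cu' := cyclically_reduced_inv la cu.
  have cv' := cyclically_reduced_inv la cv.
  have [u0 v0] := (cyclically_reduced_nil la cu, cyclically_reduced_nil la cv).
  (* A direction of [u] that coincides with one of [v] becomes a common head after inverting [u],
     [v] or both. *)
  have [huv|huv] := eqVneq (head la u) (head la v).
    exact: compatible_eq_heads.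
  have [hulv|hulv] := eqVneq (head la u) (letter_inv (last la v)).
    rewrite -(invgK (word_elt v)) -(word_elt_inv v); apply: compatible_invr.
    by apply: compatible_eq_heads => //; rewrite head_word_inv.
  have [luhv|luhv] := eqVneq (letter_inv (last la u)) (head la v).
    rewrite -(invgK (word_elt u)) -(word_elt_inv u); apply: compatible_invl.
    by apply: compatible_eq_heads => //; rewrite head_word_inv.
  have [luv|luv] := eqVneq (last la u) (last la v).
    rewrite -(invgK (word_elt u)) -(invgK (word_elt v)).
    rewrite -(word_elt_inv u) -(word_elt_inv v).
    apply: compatible_invl; apply: compatible_invr.
    by apply: compatible_eq_heads => //; rewrite !head_word_inv // luv.
  exact: compatible_four_heads.
have [us|] := boolP (bridge la u s v); first exact: compatible_bridge.
rewrite /bridge s0 rs /= andbA negb_and => /orP[us|].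
  case: s s0 szs rs us => // x s _ szs rs us.
  (* Conjugating both elements by [x^-1] rotates [u] and removes [x] from [s]. *)
  apply: (@compatible_conj (word_elt [:: letter_inv x])).
  have [|k uE] := @conj_shorten _ la [::] (letter_inv x) u cu.
    by rewrite letter_invK andbC.
  move: uE; rewrite !word_elt_conj invg1 mulg1 mul1g => ->.
  rewrite -(cat1s x s) word_elt_cat word_elt_letter_inv invgM !mulgA mulVg.
  rewrite mul1g invgK mulgVK -word_elt_conj.
  apply: IHn; rewrite ?cyclically_reduced_rot //.
  exact: path_sorted rs.
case/lastP: s s0 szs rs => // s x _; rewrite size_rcons last_rcons => szs rs.
move=> /(conj_shorten s cv)[k ->].
apply: IHn; rewrite ?cyclically_reduced_rot //.
by move: rs; rewrite /reduced -cats1 => /cat_sorted2[].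
Qed.

Lemma compatible_neq1 g h : g != 1%g -> h != 1%g -> compatible g h.
Proof.
move=> /cyclic_rep_neq1[u cu [a uE]] /cyclic_rep_neq1[v cv [b vE]].
apply: (@compatible_conj a); rewrite -uE.
(* Conjugation by [a] turns [g] into [u] and [h] into the conjugate of [v] by [c]. *)
pose c : freegroup bool := (a * b^-1)%g.
have -> : (a * h * a^-1)%g = word_elt (fg_word c ++ v ++ word_inv (fg_word c)).
  by rewrite word_elt_conj word_eltK vE invgM invgK !mulgA !mulgVK.
exact: compatible_words (valP c).
Qed.

Lemma length_pseudo_length : pseudo_length l.
Proof.
have neq1 g : 0 < l g -> g != 1%g.
  by move=> lg; apply/eqP => g1; move: lg; rewrite g1 length1 ltxx.
split.
- exact: length_ge0.
- move=> g h /neq1 g1 /neq1 h1; have [_ dbl] := compatible_neq1 g1 h1.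
  have [le|lt] := leP (l (g * h)%g - l g - l h) 0.
    by exists 0; rewrite mul0rn.
  by apply: dbl; move: lt; rewrite -addrA -opprD omod_sub_gt0.
- by move=> g h; apply: length_conj.
- move=> g h; have [->|g1] := eqVneq g 1%g.
    by left; rewrite !mul1g length_inv.
  have [->|h1] := eqVneq h 1%g; first by left; rewrite invg1.
  by have [[[]|->]] := compatible_neq1 g1 h1; [left|right].
- by move=> g h /neq1 g1 /neq1 h1; have [] := compatible_neq1 g1 h1.
Qed.
End Turns.

Theorem proposition3p7 (L : orderedZmodType) (L_nontrivial : exists x : L, x != 0)
    (alpha beta gamma delta : L)
    (h1 : in_double (gamma - alpha - beta) /\ in_double (delta - alpha - beta))
    (h2 : (gamma = delta /\ alpha + beta < delta) \/
          Num.max gamma delta = alpha + beta)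
    (h3 : [/\ 0 < alpha, 0 < beta &
              omod_abs (alpha - beta) < Num.min gamma delta])
    (f : Sigma -> Sigma -> L) (hf : is_weight alpha beta gamma delta f) :
  exists l : freegroup bool -> L,
    [/\ is_length f l,
        (forall l' : freegroup bool -> L, is_length f l' -> l' =1 l) &
        pseudo_length l].
Proof.
case: h1 h3 => [[p pE] [q qE]] [alpha_gt0 beta_gt0 ab_lt].
have {pE} gammaE : gamma = alpha + beta + p *+ 2.
  by rewrite -pE -(addrA gamma) -opprD [RHS]addrC subrK.
have {qE} deltaE : delta = alpha + beta + q *+ 2.
  by rewrite -qE -(addrA delta) -opprD [RHS]addrC subrK.
subst gamma delta.
have pq_isosceles : isosceles 0 p q.
  pose F r := alpha + beta + r *+ 2.
  apply: (@isosceles_inv_mono L F) => [r s|].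
    by rewrite /F omod_leD2l omod_le_double.
  by rewrite /F mul0rn addr0.
(* Hypothesis (3) unfolds into four inequalities of this shape, with [alpha] and [beta] in either
   order and [r] equal to [p] or [q]. *)
have arm_gt0 (x y r : L) : x - y < x + y + r *+ 2 -> 0 < y + r.
  rewrite -addrA omod_ltD2l -(omod_ltD2l y) subrr addrA -mulr2n -mulrnDl.
  by rewrite omod_double_gt0.
move: ab_lt; rewrite /omod_abs gt_max !lt_min opprB.
move=> /andP[/andP[/arm_gt0 bp /arm_gt0 bq]].
rewrite (addrC alpha) => /andP[/arm_gt0 ap /arm_gt0 aq].
have [l l_length] :=
  length_exists hf alpha_gt0 beta_gt0 ap aq bp bq pq_isosceles.
exists l; split=> // [l' l'_length|].
  by apply: (length_unique hf) l'_length.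
by apply: (length_pseudo_length hf).
Qed.
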